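(* Let $r\ge1$ and let $A\in\mathbb{R}^{n\times d}$ have rank $q>r$, with reduced singular value decomposition \[ A = U_1\Sigma_1V_1^\top + U_2\Sigma_2V_2^\top, \] where $\Sigma_1\in\mathbb{R}^{r\times r}$ contains the top $r$ singular values, $V_2 = [v_{r+1}\ \cdots\ v_q]$, and $A_r = U_1\Sigma_1V_1^\top$ is the best rank-$r$ approximation to $A$. Let $\Omega\in\mathbb{R}^{d\times k}$ be a random matrix with $k>r$, and set $\widetilde A = (A\Omega)(A\Omega)^+A$. Let $W_j=\operatorname{span}(V_1,v_j)$, $j=r+1,\dots,q$. Let $\alpha\in(0,1]$ and $\delta\in[0,1)$. Suppose $\mathbb{E}[\Omega\Omega^\top]=I_d$ and that, with probability at least $1-\delta$, $\|\Omega^\top x\|_2^2 \ge \alpha \|x\|_2^2$ holds for all $x\in W_j$ and every $j=r+1,\dots,q$. Then, for every $\eta\in(0,1)$, \[ \mathbb{P}\left\{\|A-\widetilde A\|_F^2\le\left(1+\frac{1-\alpha+\alpha\delta}{4\alpha\eta}\right)\|A-A_r\|_F^2\right\}\ge 1-\delta-\eta . \]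
   Context: ${}^+$ denotes the Moore--Penrose pseudoinverse and $\|\cdot\|_F$ the Frobenius norm. The columns of $V_1\in\mathbb{R}^{d\times r}$ are the top $r$ right singular vectors of $A$, and $v_{r+1},\dots,v_q$ are the remaining right singular vectors (corresponding to the singular values $\sigma_{r+1}\ge\dots\ge\sigma_q>0$ on the diagonal of $\Sigma_2$). $\operatorname{span}(V_1,v_j)$ denotes the span of the columns of $V_1$ together with $v_j$. *)

(* Defs.v *)
From mathcomp Require Import all_boot all_order all_algebra.
From mathcomp Require Import all_classical all_reals all_analysis.

Set Implicit Arguments.
Unset Strict Implicit.
Unset Printing Implicit Defensive.

Import Order.TTheory GRing.Theory Num.Theory.

Local Open Scope classical_set_scope.
Local Open Scope ring_scope.

(* The norm that the library puts on matrices is the max norm. *)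
Definition frobenius_norm (R : realType) m n (A : 'M[R]_(m, n)) : R :=
  Num.sqrt (\sum_i \sum_j A i j ^+ 2).

Definition l2norm (R : realType) n (x : 'cV[R]_n) : R :=
  Num.sqrt (\sum_i x i 0 ^+ 2).

(* The four Penrose equations. *)
Definition is_pseudoinverse (R : realType) m n
    (A : 'M[R]_(m, n)) (X : 'M[R]_(n, m)) : Prop :=
  [/\ A *m X *m A = A,
      X *m A *m X = X,
      (A *m X)^T = A *m X &
      (X *m A)^T = X *m A].

(* The default value 0 is never used: see [pseudoinverseP]. *)
Definition pseudoinverse (R : realType) m n (A : 'M[R]_(m, n)) : 'M[R]_(n, m) :=
  xget 0 [set X | is_pseudoinverse A X].

Lemma gram_unitmx (R : realType) m n (M : 'M[R]_(m, n)) :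
  row_free M -> M *m M^T \in unitmx.
Proof.
move=> freeM; rewrite -row_free_unit; apply: inj_row_free => u uMM0.
have uM2 : (u *m M) *m (u *m M)^T = 0.
  by rewrite trmx_mul mulmxA -(mulmxA u) uMM0 mul0mx.
suff uM0 : u *m M = 0 by apply: (row_free_inj freeM); rewrite uM0 mul0mx.
have /eqP := congr1 (fun N : 'M[R]_1 => N 0 0) uM2.
rewrite !mxE psumr_eq0 => [/allP uMi0|j _]; last first.
  by rewrite [X in _ * X]mxE -expr2 sqr_ge0.
apply/rowP => j; have := uMi0 j (mem_index_enum j).
by rewrite [X in _ * X]mxE -expr2 /= sqrf_eq0 => /eqP ->; rewrite [RHS]mxE.
Qed.

Lemma pseudoinverse_exists (R : realType) m n (A : 'M[R]_(m, n)) :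
  exists X, is_pseudoinverse A X.
Proof.
have [l [C [B [AE uB uC]]]] : exists l (C : 'M[R]_(m, l)) (B : 'M[R]_(l, n)),
    [/\ A = C *m B, B *m B^T \in unitmx & C^T *m C \in unitmx].
  exists (\rank A), (col_base A), (row_base A); split.
  - by rewrite mulmx_base.
  - exact/gram_unitmx/row_base_free.
  - have := @gram_unitmx _ _ _ (col_base A)^T; rewrite trmxK; apply.
    by rewrite -row_leq_rank mxrank_tr col_leq_rank col_base_full.
set G := invmx (B *m B^T); set H := invmx (C^T *m C).
have GT : G^T = G by rewrite /G trmx_inv trmx_mul trmxK.
have HT : H^T = H by rewrite /H trmx_inv trmx_mul trmxK.
pose X := B^T *m G *m H *m C^T.
have AX : A *m X = C *m H *m C^T.
  by rewrite AE /X !mulmxA -(mulmxA C B) -(mulmxA C) mulmxV // mulmx1.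
have XA : X *m A = B^T *m G *m B.
  by rewrite AE /X !mulmxA -(mulmxA _ C^T C) -(mulmxA _ H) mulVmx // mulmx1.
exists X; split.
- by rewrite AX AE !mulmxA -(mulmxA _ C^T C) -(mulmxA _ H) mulVmx // mulmx1.
- rewrite XA /X !mulmxA -(mulmxA _ B B^T) -(mulmxA _ G (B *m _)).
  by rewrite mulVmx // mulmx1.
- by rewrite AX !trmx_mul trmxK HT mulmxA.
- by rewrite XA !trmx_mul trmxK GT mulmxA.
Qed.

Lemma pseudoinverse_unique (R : realType) m n (A : 'M[R]_(m, n)) X Y :
  is_pseudoinverse A X -> is_pseudoinverse A Y -> X = Y.
Proof.
move=> [AXA XAX AXT XAT] [AYA YAY AYT YAT].
have AE : A *m X = A *m Y.
  by rewrite -AXT -{1}AYA -(mulmxA (A *m Y)) trmx_mul AXT AYT mulmxA AXA.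
have EA : X *m A = Y *m A.
  by rewrite -XAT -{1}AYA -(mulmxA A) mulmxA trmx_mul XAT YAT -mulmxA
    [A *m (X *m A)]mulmxA AXA.
by rewrite -XAX EA -mulmxA AE mulmxA.
Qed.

Lemma pseudoinverseP (R : realType) m n (A : 'M[R]_(m, n)) :
  is_pseudoinverse A (pseudoinverse A).
Proof.
exact: (xgetPex (P := [set X | is_pseudoinverse A X]) 0 (pseudoinverse_exists A)).
Qed.

Definition sketch_approx (R : realType) n d k
    (A : 'M[R]_(n, d)) (Om : 'M[R]_(d, k)) : 'M[R]_(n, d) :=
  (A *m Om) *m pseudoinverse (A *m Om) *m A.

(* Reduced singular value decomposition with the singular values split into
   a leading block s1 and a trailing block s2; row_mx joins the blocks, so the
   orthonormality and ordering conditions also hold across them. *)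
Definition reduced_svd (R : realType) n d r p (A : 'M[R]_(n, d))
    (U1 : 'M[R]_(n, r)) (s1 : 'rV[R]_r) (V1 : 'M[R]_(d, r))
    (U2 : 'M[R]_(n, p)) (s2 : 'rV[R]_p) (V2 : 'M[R]_(d, p)) : Prop :=
  [/\ A = U1 *m diag_mx s1 *m V1^T + U2 *m diag_mx s2 *m V2^T,
      (row_mx U1 U2)^T *m row_mx U1 U2 = 1%:M,
      (row_mx V1 V2)^T *m row_mx V1 V2 = 1%:M,
      forall i, 0 < row_mx s1 s2 0 i &
      forall i j : 'I_(r + p), (i <= j)%N ->
        row_mx s1 s2 0 j <= row_mx s1 s2 0 i].

Definition span_with (R : realType) d r
    (V1 : 'M[R]_(d, r)) (v : 'cV[R]_d) : {vspace 'cV[R]_d} :=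
  (<<[seq col i V1 | i : 'I_r]>> + <[v]>)%VS.

(* Matrices carry no sigma-algebra in the library. *)
Definition random_matrix (R : realType) (disp : measure_display)
    (T : measurableType disp) m n (X : T -> 'M[R]_(m, n)) : Prop :=
  forall i j, measurable_fun [set: T] (fun w => X w i j).

(* Expectations are extended-real valued, hence so are the entries. *)
Definition expectation_mx (R : realType) (disp : measure_display)
    (T : measurableType disp) (P : probability T R) m n
    (X : T -> 'M[R]_(m, n)) : 'M[\bar R]_(m, n) :=
  \matrix_(i, j) 'E_P[fun w => X w i j]%E.

(* Main.v *)
(* Write M = Omega^T V1 and N = Omega^T V2, and let Z = M^+ N hold the
   least-squares coefficients of the columns of N.  Since A~ is the orthogonal
   projection of A on the range of A Omega, it is at least as close to A as
   A Omega (M^+)^T V1^T, whose squared error is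
   sum_j sigma_j^2 (1 + |z_j|^2).  Testing injectivity on v_j - 2 V1 z_j bounds
   4 alpha |z_j|^2 by |Omega^T v_j|^2 - alpha, so that on the good event the
   excess error is at most (S - alpha tau) / (4 alpha), where
   S = sum_j sigma_j^2 |Omega^T v_j|^2 has mean tau = |A - A_r|^2 by isotropy.
   Markov's inequality on the good event concludes. *)
Require Import Defs.
From mathcomp Require Import all_boot all_order all_algebra.
From mathcomp Require Import all_classical all_reals all_analysis.
From mathcomp Require Import measurable_realfun ring lra.

Set Implicit Arguments.
Unset Strict Implicit.
Unset Printing Implicit Defensive.

Import Order.TTheory GRing.Theory Num.Theory.
Import numFieldNormedType.Exports.

Local Open Scope classical_set_scope.
Local Open Scope ring_scope.

(** * Norms as traces and entries of Gram matrices *)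

Lemma frobenius_norm_sqr (R : realType) m n (M : 'M[R]_(m, n)) :
  frobenius_norm M ^+ 2 = \tr (M^T *m M).
Proof.
rewrite /frobenius_norm sqr_sqrtr; last first.
  by apply: sumr_ge0 => i _; apply: sumr_ge0 => j _; rewrite sqr_ge0.
rewrite exchange_big; apply: eq_bigr => j _; rewrite mxE.
by apply: eq_bigr => i _; rewrite !mxE expr2.
Qed.

Lemma l2norm_sqr (R : realType) n (x : 'cV[R]_n) :
  l2norm x ^+ 2 = (x^T *m x) 0 0.
Proof.
rewrite /l2norm sqr_sqrtr; last by apply: sumr_ge0 => i _; rewrite sqr_ge0.
by rewrite mxE; apply: eq_bigr => i _; rewrite mxE expr2.
Qed.

Lemma mulmx_col (R : realType) m n p (A : 'M[R]_(m, n)) (B : 'M[R]_(n, p)) j :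
  A *m col j B = col j (A *m B).
Proof.
by apply/colP => i; rewrite !mxE; apply: eq_bigr => l _; rewrite mxE.
Qed.

Lemma l2norm_col_sqr (R : realType) m n (M : 'M[R]_(m, n)) j :
  l2norm (col j M) ^+ 2 = (M^T *m M) j j.
Proof.
by rewrite l2norm_sqr tr_col !mxE; apply: eq_bigr => i _; rewrite !mxE.
Qed.

Lemma l2norm_eq0 (R : realType) n (x : 'cV[R]_n) : (l2norm x == 0) = (x == 0).
Proof.
have sq_ge0 i : true -> 0 <= x i 0 ^+ 2 by rewrite sqr_ge0.
apply/idP/eqP => [|->]; last first.
  by rewrite /l2norm big1 ?sqrtr0// => i _; rewrite mxE expr0n.
rewrite sqrtr_eq0 => le0.
have /eqP : \sum_i x i 0 ^+ 2 = 0 by apply/le_anti; rewrite le0 sumr_ge0.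
rewrite psumr_eq0// => /allP x0; apply/colP => i; rewrite mxE.
by have := x0 i (mem_index_enum i); rewrite /= sqrf_eq0 => /eqP.
Qed.

Lemma mxtrace_gram_diag (R : realType) m n (s : 'rV[R]_n) (W : 'M[R]_(m, n)) :
  \tr ((W *m diag_mx s)^T *m (W *m diag_mx s)) =
  \sum_j s 0 j ^+ 2 * (W^T *m W) j j.
Proof.
rewrite trmx_mul tr_diag_mx !mulmxA -(mulmxA _ _ W) mul_diag_mx mul_mx_diag.
by apply: eq_bigr => j _; rewrite !mxE; ring.
Qed.

(** The orthonormal columns of [U] cancel in the Gram matrix, and cyclicity of the trace then leaves
    only the diagonal of [W^T *m W]. *)
Lemma frobenius_norm_svd_sqr (R : realType) m n p (U : 'M[R]_(m, p))
    (s : 'rV[R]_p) (W : 'M[R]_(n, p)) :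
  U^T *m U = 1%:M ->
  frobenius_norm (U *m diag_mx s *m W^T) ^+ 2 =
  \sum_j s 0 j ^+ 2 * (W^T *m W) j j.
Proof.
move=> UU; rewrite frobenius_norm_sqr -mxtrace_gram_diag [in RHS]mxtrace_mulC.
rewrite !trmx_mul trmxK tr_diag_mx; congr (\tr _).
by rewrite !mulmxA -(mulmxA _ U^T) UU mulmx1.
Qed.

Lemma reduced_svd_orthonormal (R : realType) n d r p (A : 'M[R]_(n, d))
    (U1 : 'M[R]_(n, r)) (s1 : 'rV[R]_r) (V1 : 'M[R]_(d, r))
    (U2 : 'M[R]_(n, p)) (s2 : 'rV[R]_p) (V2 : 'M[R]_(d, p)) :
  reduced_svd A U1 s1 V1 U2 s2 V2 ->
  [/\ U2^T *m U2 = 1%:M, V1^T *m V1 = 1%:M, V2^T *m V2 = 1%:M &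
      V1^T *m V2 = 0].
Proof.
case=> _ + + _ _; rewrite !tr_row_mx !mul_col_row !(@scalar_mx_block _ r p).
by move=> /eq_block_mx[_ _ _ UU] /eq_block_mx[? ? _ ?].
Qed.

(** * Least squares and optimality of the projection *)

Lemma pseudoinverse_normal_eq (R : realType) m n p (M : 'M[R]_(m, n))
    (N : 'M[R]_(m, p)) :
  M^T *m M *m (pseudoinverse M *m N) = M^T *m N.
Proof.
have [MXM _ MXT _] := pseudoinverseP M.
by rewrite mulmxA -(mulmxA M^T) -MXT -trmx_mul MXM.
Qed.

(** With [Y = A *m Om], the matrix [Q = Y Y^+] is the orthogonal projector on the range of [Y]. As
    [Q Y = Y], the error of [Y X] splits into [A - Q A] and [Q (A - Y X)], which are orthogonal, so
    Pythagoras applies. *)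
Lemma sketch_approx_le (R : realType) n d k (A : 'M[R]_(n, d))
    (Om : 'M[R]_(d, k)) (X : 'M[R]_(k, d)) :
  frobenius_norm (A - sketch_approx A Om) ^+ 2 <=
  frobenius_norm (A - A *m Om *m X) ^+ 2.
Proof.
rewrite /sketch_approx; set Y := A *m Om; set Q := Y *m pseudoinverse Y.
have [YXY _ QT _] := pseudoinverseP Y; rewrite -/Q in YXY QT.
have QQ : Q *m Q = Q by rewrite {2}/Q mulmxA YXY.
clearbody Q.
set N := A - Y *m X.
have NE : N = (A - Q *m A) + Q *m N.
  by rewrite /N mulmxBr mulmxA YXY addrA addrNK.
have orth : (A - Q *m A)^T *m (Q *m N) = 0.
  rewrite linearB /= trmx_mul QT mulmxBl !mulmxA -(mulmxA _ Q Q) QQ.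
  by rewrite subrr.
have orth' : (Q *m N)^T *m (A - Q *m A) = 0.
  by apply: trmx_inj; rewrite trmx_mul trmxK orth !trmx0.
move: (A - _) (Q *m N) NE orth orth' => B C -> orth orth'.
rewrite !frobenius_norm_sqr.
have -> : (B + C)^T = B^T + C^T by rewrite linearD.
rewrite mulmxDl !mulmxDr orth orth' addr0 add0r.
rewrite mxtraceD lerDl.
by rewrite -frobenius_norm_sqr sqr_ge0.
Qed.

(** * Subspace injection and the deterministic error bound *)

Lemma mem_span_with (R : realType) d r (V1 : 'M[R]_(d, r)) (v x : 'cV[R]_d) :
  x \in span_with V1 v <-> exists (y : 'cV[R]_r) (c : R), x = V1 *m y + c *: v.
Proof.
split=> [/memv_addP[u uV1 [_ /vlineP[c ->] ->]]|[y [c ->]]].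
  have sub :
      (<<[seq col i V1 | i : 'I_r]>> <= limg (linfun (mulmx V1)))%VS.
    apply/span_subvP => _ /mapP[i _ ->]; apply/memv_imgP.
    exists (delta_mx i 0); first by rewrite memvf.
    by rewrite lfunE /= colE.
  move/subvP: sub => /(_ _ uV1)/memv_imgP[y _ ->].
  by exists y, c; rewrite lfunE.
apply: memv_add; last exact/memvZ/memv_line.
have -> : V1 *m y = \sum_i y i 0 *: col i V1.
  apply/colP => l; rewrite !mxE summxE; apply: eq_bigr => i _.
  by rewrite !mxE mulrC.
by apply: memv_suml => i _; apply/memvZ/memv_span/map_f; rewrite mem_enum.
Qed.

(** Convertible to the condition for one [j] inside the event of the hypothesis
    [subspace_injection]. *)
Definition injects_on (R : realType) d k (alpha : R) (Om : 'M[R]_(d, k))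
    (W : {vspace 'cV[R]_d}) : Prop :=
  forall x, x \in W -> alpha * l2norm x ^+ 2 <= l2norm (Om^T *m x) ^+ 2.

(** Since [alpha > 0] and [V1] preserves norms, [M = Om^T *m V1] is injective, so it can be
    cancelled in [M (M^+ M - 1) = 0], column by column. *)
Lemma injects_on_mulVmx (R : realType) d k r (alpha : R) (Om : 'M[R]_(d, k))
    (V1 : 'M[R]_(d, r)) (v : 'cV[R]_d) :
  0 < alpha -> V1^T *m V1 = 1%:M -> injects_on alpha Om (span_with V1 v) ->
  pseudoinverse (Om^T *m V1) *m (Om^T *m V1) = 1%:M.
Proof.
move=> alpha_gt0 VV inj; set M := Om^T *m V1.
have [MXM _ _ _] := pseudoinverseP M.
have M_inj (y : 'cV[R]_r) : M *m y = 0 -> y = 0.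
  move=> My0; have /inj : V1 *m y \in span_with V1 v.
    by apply/mem_span_with; exists y, 0; rewrite scale0r addr0.
  rewrite mulmxA -/M My0 !l2norm_sqr mulmx0 [leRHS]mxE trmx_mul.
  rewrite mulmxA -(mulmxA y^T) VV mulmx1 -l2norm_sqr => le0.
  apply/eqP; rewrite -l2norm_eq0 -sqrf_eq0; apply/eqP/le_anti.
  by rewrite sqr_ge0 andbT -(pmulr_rle0 _ alpha_gt0).
apply/eqP; rewrite -subr_eq0; apply/eqP/matrixP => i j.
have /M_inj/colP/(_ i) : M *m col j (pseudoinverse M *m M - 1%:M) = 0.
  by rewrite mulmx_col mulmxBr mulmxA MXM mulmx1 subrr col0.
by rewrite !mxE.
Qed.

Lemma gram_sub (R : realType) m n (B C : 'M[R]_(m, n)) :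
  (B - C)^T *m (B - C) = B^T *m B - B^T *m C - (C^T *m B - C^T *m C).
Proof.
have -> : (B - C)^T = B^T - C^T by rewrite linearB.
by rewrite mulmxBl !mulmxBr.
Qed.

Lemma gram_orthonormal_sub (R : realType) d r p (V1 : 'M[R]_(d, r))
    (V2 : 'M[R]_(d, p)) (C : 'M[R]_(r, p)) :
  V1^T *m V1 = 1%:M -> V2^T *m V2 = 1%:M -> V1^T *m V2 = 0 ->
  (V2 - V1 *m C)^T *m (V2 - V1 *m C) = 1%:M + C^T *m C.
Proof.
move=> VV1 VV2 V12.
have V21 : V2^T *m V1 = 0 by rewrite -[V1]trmxK -trmx_mul V12 trmx0.
rewrite gram_sub VV2 trmx_mul -(mulmxA _ _ V2) V12 mulmx0 mulmxA V21 mul0mx.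
by rewrite mulmxA -(mulmxA _ _ V1) VV1 mulmx1 subr0 sub0r opprK.
Qed.

(* For [z] the least-squares coefficients, [Om^T (v - 2 V1 z)] is the reflection
   of [Om^T v] in the orthogonal complement of the range of [Om^T V1], so it has
   the same norm, while [|v - 2 V1 z|^2 = 1 + 4 |z|^2]. *)
Lemma regression_coef_le (R : realType) d k r p (alpha : R)
    (Om : 'M[R]_(d, k)) (V1 : 'M[R]_(d, r)) (V2 : 'M[R]_(d, p)) (j : 'I_p)
    (Z : 'M[R]_(r, p)) :
  V1^T *m V1 = 1%:M -> V2^T *m V2 = 1%:M -> V1^T *m V2 = 0 ->
  injects_on alpha Om (span_with V1 (col j V2)) ->
  (Om^T *m V1)^T *m (Om^T *m V1) *m Z = (Om^T *m V1)^T *m (Om^T *m V2) ->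
  alpha * (1 + 4 * (Z^T *m Z) j j) <=
  ((Om^T *m V2)^T *m (Om^T *m V2)) j j.
Proof.
move=> VV1 VV2 V12 inj; set M := Om^T *m V1; set N := Om^T *m V2 => normal.
have ME : Om^T *m V1 = M by [].
have NE : Om^T *m V2 = N by [].
clearbody M N.
(* By the normal equations both sides equal [Z^T M^T M Z]. *)
have normalT : N^T *m M *m Z = Z^T *m M^T *m N.
  have -> : N^T *m M = Z^T *m (M^T *m M).
    by apply: trmx_inj; rewrite !trmx_mul !trmxK normal.
  by rewrite -!mulmxA -normal !mulmxA.
pose W := V2 - V1 *m (2 *: Z).
have /inj : col j W \in span_with V1 (col j V2).
  apply/mem_span_with; exists (col j (- (2 *: Z))), 1.
  by rewrite mulmx_col mulmxN scale1r addrC /W; apply/colP => i; rewrite !mxE.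
rewrite mulmx_col !l2norm_col_sqr gram_orthonormal_sub//.
have -> : Om^T *m W = N - M *m (2 *: Z) by rewrite mulmxBr mulmxA ME NE.
(* The two cross terms contribute [-4 Z^T M^T N], cancelled by the quadratic term
   [4 Z^T M^T M Z]. *)
have -> : (N - M *m (2 *: Z))^T *m (N - M *m (2 *: Z)) = N^T *m N.
  rewrite gram_sub trmx_mul -[_ *m M^T *m (_ *m _)]mulmxA (mulmxA M^T M).
  rewrite -!scalemxAr normal (mulmxA N^T) normalT.
  have -> : (2 *: Z)^T = 2 *: Z^T by rewrite linearZ.
  rewrite -!scalemxAl !mulmxA.
  by rewrite [2 *: (2 *: _)]scaler_nat mulr2n opprB addrK subrK.
have -> : (2 *: Z)^T *m (2 *: Z) = 4 *: (Z^T *m Z).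
  have -> : (2 *: Z)^T = 2 *: Z^T by rewrite linearZ.
  by rewrite -scalemxAl -scalemxAr scalerA -natrM.
by rewrite !mxE eqxx.
Qed.

Lemma sketch_error_le (R : realType) n d k r p (alpha : R) (A : 'M[R]_(n, d))
    (U1 : 'M[R]_(n, r)) (s1 : 'rV[R]_r) (V1 : 'M[R]_(d, r))
    (U2 : 'M[R]_(n, p)) (s2 : 'rV[R]_p) (V2 : 'M[R]_(d, p))
    (Om : 'M[R]_(d, k)) :
  0 < alpha -> (0 < p)%N -> reduced_svd A U1 s1 V1 U2 s2 V2 ->
  (forall j, injects_on alpha Om (span_with V1 (col j V2))) ->
  frobenius_norm (A - sketch_approx A Om) ^+ 2 <=
  \sum_j s2 0 j ^+ 2 +
  (\sum_j s2 0 j ^+ 2 * l2norm (Om^T *m col j V2) ^+ 2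
     - alpha * \sum_j s2 0 j ^+ 2) / (4 * alpha).
Proof.
move=> alpha_gt0 p_gt0 svd inj.
have [UU VV1 VV2 V12] := reduced_svd_orthonormal svd.
(* Any single index suffices, because each subspace contains the columns of [V1]; [0 < p] provides
   one. *)
have Minv := injects_on_mulVmx alpha_gt0 VV1 (inj (Ordinal p_gt0)).
have reg j := regression_coef_le VV1 VV2 V12 (inj j)
  (pseudoinverse_normal_eq (Om^T *m V1) (Om^T *m V2)).
move: Minv reg; set M := Om^T *m V1; set N := Om^T *m V2.
set X := pseudoinverse M; set Z := X *m N => XM reg.
(* Since [M^+ M = 1], this competitor reproduces the leading block of [A] exactly, and its remaining
   error involves only [s2] and [V2 - V1 Z]. *)
apply: le_trans (sketch_approx_le A Om (X^T *m V1^T)) _.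
have -> : A - A *m Om *m (X^T *m V1^T) =
    U2 *m diag_mx s2 *m (V2 - V1 *m Z)^T.
  have e1 : V1^T *m Om *m X^T = 1%:M.
    by rewrite -trmx1 -XM !trmx_mul trmxK.
  have e2 : V2^T *m Om *m X^T = Z^T by rewrite !trmx_mul trmxK.
  have [-> _ _ _ _] := svd.
  have -> : (V2 - V1 *m Z)^T = V2^T - Z^T *m V1^T.
    by rewrite -trmx_mul linearB.
  rewrite mulmxBr !mulmxDl !mulmxA -!(mulmxA _ V1^T Om) -!(mulmxA _ V2^T Om).
  rewrite -(mulmxA _ (V1^T *m Om)) e1 -(mulmxA _ (V2^T *m Om)) e2 mulmx1.
  by rewrite opprD addrACA subrr add0r.
rewrite frobenius_norm_svd_sqr//.
under [leLHS]eq_bigr do rewrite gram_orthonormal_sub//.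
rewrite mulr_sumr -sumrB mulr_suml -big_split /=; apply: ler_sum => j _.
rewrite mulmx_col l2norm_col_sqr -/N.
have a4 : 0 < 4 * alpha by rewrite mulr_gt0.
have s_ge0 : 0 <= s2 0 j ^+ 2 by rewrite sqr_ge0.
have -> : (1%:M + Z^T *m Z) j j = 1 + (Z^T *m Z) j j.
  by rewrite mxE [1%:M j j]mxE eqxx.
(* What remains for each [j] is the bound [reg j] on the regression coefficients, weighted by the
   squared singular value. *)
rewrite -lerBlDl ler_pdivlMr//.
have := ler_wpM2l s_ge0 (reg j); lra.
Qed.

(** * Entrywise limits and density of rational matrices *)

Definition entrywise_cvg (R : realType) m n (u : nat -> 'M[R]_(m, n))
    (M : 'M[R]_(m, n)) : Prop :=
  forall i j, u t i j @[t --> \oo] --> M i j.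

Lemma ratr_dense_cvg (R : realType) (x : R) :
  exists q : nat -> rat, (ratr (q t) : R) @[t --> \oo] --> x.
Proof.
have /choice[q xq] (t : nat) : exists q, x < ratr q < x + t.+1%:R^-1.
  have /rat_in_itvoo[q] : x < x + t.+1%:R^-1 by rewrite ltrDl invr_gt0.
  by rewrite in_itv /=; exists q.
exists q; apply: (@squeeze_cvgr _ _ _ _ (cst x) (fun t => x + t.+1%:R^-1)).
- by apply: nearW => t; have /andP[/ltW -> /ltW ->] := xq t.
- exact: cvg_cst.
- rewrite -[X in _ --> X]addr0.
  by apply: cvgD; [exact: cvg_cst|exact: cvg_harmonic].
Qed.

Lemma rational_mx_dense (R : realType) m n (M : 'M[R]_(m, n)) :
  exists u : nat -> 'M[rat]_(m, n),
    entrywise_cvg (fun t => map_mx ratr (u t)) M.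
Proof.
have /choice[q qM] (ij : 'I_m * 'I_n) := ratr_dense_cvg (M ij.1 ij.2).
exists (fun t => \matrix_(i, j) q (i, j) t) => i j.
have := qM (i, j); apply: cvg_trans.
by apply: near_eq_cvg; apply: nearW => t; rewrite !mxE.
Qed.

Lemma cvg_sum_fun (R : realType) (I : Type) (r : seq I) (f : I -> nat -> R)
    (l : I -> R) :
  (forall i, f i t @[t --> \oo] --> l i) ->
  \sum_(i <- r) f i t @[t --> \oo] --> \sum_(i <- r) l i.
Proof. by move=> fl; apply: cvg_big => //; exact: add_continuous. Qed.

Lemma entrywise_cvg_cst (R : realType) m n (M : 'M[R]_(m, n)) :
  entrywise_cvg (fun=> M) M.
Proof. by move=> i j; exact: cvg_cst. Qed.

Lemma entrywise_cvgD (R : realType) m n (u v : nat -> 'M[R]_(m, n)) M N :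
  entrywise_cvg u M -> entrywise_cvg v N ->
  entrywise_cvg (fun t => u t + v t) (M + N).
Proof.
move=> uM vN i j; rewrite mxE.
rewrite [X in X @ _](_ : _ = (fun t => u t i j + v t i j)).
  by apply: cvgD; [exact: uM|exact: vN].
by apply/funext => t; rewrite mxE.
Qed.

Lemma entrywise_cvg_mull (R : realType) m n p (B : 'M[R]_(m, n))
    (u : nat -> 'M[R]_(n, p)) M :
  entrywise_cvg u M -> entrywise_cvg (fun t => B *m u t) (B *m M).
Proof.
move=> uM i j; rewrite mxE.
rewrite [X in X @ _](_ : _ = (fun t => \sum_l B i l * u t l j)).
  by apply: cvg_sum_fun => l; apply: cvgM; [exact: cvg_cst|exact: uM].
by apply/funext => t; rewrite mxE.
Qed.

Lemma cvg_frobenius_norm_sqr (R : realType) m n (u : nat -> 'M[R]_(m, n)) M :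
  entrywise_cvg u M ->
  frobenius_norm (u t) ^+ 2 @[t --> \oo] --> frobenius_norm M ^+ 2.
Proof.
move=> uM; rewrite /frobenius_norm sqr_sqrtr; last first.
  by apply: sumr_ge0 => i _; apply: sumr_ge0 => j _; rewrite sqr_ge0.
rewrite [X in X @ _](_ : _ = (fun t => \sum_i \sum_j u t i j ^+ 2)).
  do 2![apply: cvg_sum_fun => ?]; rewrite expr2.
  by under eq_fun do rewrite expr2; apply: cvgM; exact: uM.
apply/funext => t; rewrite sqr_sqrtr//.
by apply: sumr_ge0 => i _; apply: sumr_ge0 => j _; rewrite sqr_ge0.
Qed.

Lemma l2norm_frobenius (R : realType) n (x : 'cV[R]_n) :
  l2norm x = frobenius_norm x.
Proof. by congr Num.sqrt; apply: eq_bigr => i _; rewrite big_ord1. Qed.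

(** * Measurability of the injection and error events *)

Lemma random_matrix_cst (R : realType) d (T : measurableType d) m n
    (M : 'M[R]_(m, n)) : random_matrix (fun _ : T => M).
Proof. by move=> i j; exact: measurable_cst. Qed.

Lemma random_matrix_tr (R : realType) d (T : measurableType d) m n
    (X : T -> 'M[R]_(m, n)) :
  random_matrix X -> random_matrix (fun w => (X w)^T).
Proof. by move=> mX i j; under eq_fun do rewrite mxE; exact: mX. Qed.

Lemma random_matrixB (R : realType) d (T : measurableType d) m n
    (X Y : T -> 'M[R]_(m, n)) :
  random_matrix X -> random_matrix Y -> random_matrix (fun w => X w - Y w).
Proof.
move=> mX mY i j; under eq_fun do rewrite !mxE.
by apply: measurable_funB; [exact: mX|exact: mY].
Qed.

Lemma random_matrixM (R : realType) d (T : measurableType d) m n p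
    (X : T -> 'M[R]_(m, n)) (Y : T -> 'M[R]_(n, p)) :
  random_matrix X -> random_matrix Y -> random_matrix (fun w => X w *m Y w).
Proof.
move=> mX mY i j; under eq_fun do rewrite !mxE.
apply: measurable_sum => l.
by apply: measurable_funM; [exact: mX|exact: mY].
Qed.

Lemma measurable_frobenius_norm_sqr (R : realType) d (T : measurableType d) m n
    (X : T -> 'M[R]_(m, n)) :
  random_matrix X ->
  measurable_fun [set: T] (fun w => frobenius_norm (X w) ^+ 2).
Proof.
move=> mX; under eq_fun do rewrite frobenius_norm_sqr.
apply: measurable_sum => i.
exact: (random_matrixM (random_matrix_tr mX) mX).
Qed.

Lemma countable_bigcapT_measurable (d : measure_display) (T : measurableType d)
    (U : countType) (F : U -> set T) :
  (forall i, measurable (F i)) -> measurable (\bigcap_i F i).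
Proof.
move=> mF; rewrite -[X in measurable X]setCK setC_bigcap; apply: measurableC.
apply: countable_bigcupT_measurable => [|i]; first exact: countableP.
exact: measurableC.
Qed.

(** The condition ranges over uncountably many vectors. Both sides are continuous in the coordinates
    of [x] along [V1] and [v_j], so rational coordinates suffice and the event is a countable
    intersection. *)
Lemma measurable_injects_on (R : realType) (disp : measure_display)
    (T : measurableType disp) d k r p (Om : T -> 'M[R]_(d, k)) (alpha : R)
    (V1 : 'M[R]_(d, r)) (V2 : 'M[R]_(d, p)) :
  random_matrix Om ->
  measurable [set w | forall j,
    injects_on alpha (Om w) (span_with V1 (col j V2))].
Proof.
move=> mOm.
pose vec j (y : 'M[R]_(r + 1, 1)) := row_mx V1 (col j V2) *m y.
pose F (jy : 'I_p * 'M[rat]_(r + 1, 1)) := [set: T] `&` [set w |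
  alpha * frobenius_norm (vec jy.1 (map_mx ratr jy.2)) ^+ 2 <=
  frobenius_norm ((Om w)^T *m vec jy.1 (map_mx ratr jy.2)) ^+ 2].
rewrite (_ : [set w | _] = \bigcap_jy F jy).
  apply: countable_bigcapT_measurable => -[j y].
  apply: measurable_fun_le => //; apply: measurable_frobenius_norm_sqr.
  by apply: random_matrixM; [exact: random_matrix_tr|exact: random_matrix_cst].
apply/seteqP; split => w /=.
  move=> inj [j y] _; split=> //=; rewrite -!l2norm_frobenius; apply: inj.
  apply/mem_span_with; exists (usubmx (map_mx ratr y)).
  exists (dsubmx (map_mx ratr y) 0 0).
  rewrite /vec -[X in _ *m X]vsubmxK mul_row_col; congr (_ + _).
  by rewrite [X in _ *m X]mx11_scalar mul_mx_scalar.
move=> Fw j x /mem_span_with[y [c xE]].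
have {xE}-> : x = vec j (col_mx y c%:M).
  by rewrite /vec mul_row_col mul_mx_scalar.
rewrite !l2norm_frobenius.
(* Real coordinates are limits of rational ones, and the non-strict inequality survives the
   limit. *)
have [u uy] := rational_mx_dense (col_mx y c%:M).
have cu := entrywise_cvg_mull (B := row_mx V1 (col j V2)) uy.
apply: (@ler_cvg_to nat \oo _ R
  (fun t => alpha * frobenius_norm (vec j (map_mx ratr (u t))) ^+ 2)
  (fun t => frobenius_norm ((Om w)^T *m vec j (map_mx ratr (u t))) ^+ 2)).
- by apply: cvgM; [exact: cvg_cst|exact: cvg_frobenius_norm_sqr].
- by apply: cvg_frobenius_norm_sqr; exact: entrywise_cvg_mull.
- by apply: nearW => t; have [] := Fw (j, u t) I.
Qed.

(* The best approximation of [A] in the column space of [A Om] is also the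
   infimum over rational coefficient matrices, which makes the sublevel sets
   countable combinations of measurable sets although the pseudoinverse is
   discontinuous. *)
Lemma measurable_sketch_error_le (R : realType) (disp : measure_display)
    (T : measurableType disp) n d k (A : 'M[R]_(n, d)) (Om : T -> 'M[R]_(d, k))
    (t : R) :
  random_matrix Om ->
  measurable
    [set w | frobenius_norm (A - sketch_approx A (Om w)) ^+ 2 <= t].
Proof.
move=> mOm.
(* On [F e X] the coefficients [X] have squared error strictly below [t + 1/(e+1)]. The slack is
   there because no rational [X] need attain the infimum. *)
pose F (e : nat) (X : 'M[rat]_(k, d)) := ~` ([set: T] `&` [set w |
  t + e.+1%:R^-1 <= frobenius_norm (A - A *m Om w *m map_mx ratr X) ^+ 2]).
rewrite (_ : [set w | _] = \bigcap_e \bigcup_X F e X).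
  apply: bigcapT_measurable => e; apply: countable_bigcupT_measurable => [|X].
    exact: countableP.
  apply/measurableC/measurable_fun_le => //.
  apply: measurable_frobenius_norm_sqr; apply: random_matrixB.
    exact: random_matrix_cst.
  apply: random_matrixM; last exact: random_matrix_cst.
  by apply: random_matrixM => //; exact: random_matrix_cst.
apply/seteqP; split => w /=.
  move=> le_t e _.
  (* Rational approximations of the optimal coefficients have errors converging to the sketch error,
     hence eventually below the relaxed threshold. *)
  have [u uX] := rational_mx_dense (pseudoinverse (A *m Om w) *m A).
  have /cvgr_lt/(_ (t + e.+1%:R^-1)) : frobenius_norm
      (A + (- (A *m Om w)) *m map_mx ratr (u s)) ^+ 2 @[s --> \oo] -->
      frobenius_norm (A - sketch_approx A (Om w)) ^+ 2.
    apply: cvg_frobenius_norm_sqr; rewrite /sketch_approx.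
    rewrite -mulmxA -(mulNmx (A *m Om w)).
    apply: entrywise_cvgD; first exact: entrywise_cvg_cst.
    exact: entrywise_cvg_mull.
  have lt_t : t < t + e.+1%:R^-1 by rewrite ltrDl invr_gt0.
  move=> /(_ (le_lt_trans le_t lt_t)) /filter_ex[s lt_s].
  exists (u s) => //; rewrite /F /= => -[_]; apply/negP.
  by rewrite -ltNge -(mulNmx (A *m Om w)).
move=> Fw; apply/ler_addgt0Pr => e e_gt0.
have [s lt_e] : exists s : nat, s.+1%:R^-1 < e.
  have /filter_ex[s lt_e] := near_infty_natSinv_lt (PosNum e_gt0).
  by exists s.
have [X _ /=] := Fw s I; rewrite /F /= => /not_andP[//|/negP].
rewrite -ltNge => lt_s.
(* Conversely, optimality of the projection bounds the sketch error by that of any rational [X],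
   here below [t + e]. *)
apply: le_trans (sketch_approx_le _ _ (map_mx ratr X)) _.
by apply: (le_trans (ltW lt_s)); rewrite lerD2l ltW.
Qed.

(** * Markov's inequality on the good event *)

Lemma probability_fin (R : realType) d (T : measurableType d)
    (P : probability T R) (E : set T) :
  measurable E -> exists p : R, P E = p%:E.
Proof.
by move=> mE; exists (fine (P E)); rewrite fineK// fin_num_measure.
Qed.

(** Here [f] is nonnegative only on [E], and the strict excess [f > K] keeps the bound meaningful at
    [K = 0], which occurs below for [alpha = 1] and [delta = 0]. *)
Lemma markov_gt (R : realType) d (T : measurableType d)
    (P : probability T R) (E : set T) (f : T -> R) (K eta : R) :
  measurable E -> measurable_fun [set: T] f -> (forall x, E x -> 0 <= f x) ->
  0 <= K -> 0 <= eta ->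
  (\int[P]_(x in E) (f x)%:E <= (eta * K)%:E)%E ->
  (P (E `\` [set x | (f x <= K)%R]) <= eta%:E)%E.
Proof.
move=> mE mf f_ge0 K_ge0 eta_ge0 intf; set F := E `\` _.
have FE : F `<=` E by move=> x [].
have FK x : F x -> K < f x by move=> [_] /= /negP; rewrite -ltNge.
have mF : measurable F.
  apply: measurableD => //; rewrite -[X in measurable X]setTI.
  by apply: measurable_fun_le => //; exact: measurable_cst.
have mfE A : measurable A -> measurable_fun A (fun x => (f x)%:E).
  by move=> mA; apply/measurable_EFinP; exact: measurable_funTS.
have intF : (\int[P]_(x in F) (f x)%:E <= (eta * K)%:E)%E.
  apply: le_trans intf; apply: ge0_subset_integral => //; exact: mfE.
(* At [K = 0] division is impossible; instead [f] is positive on [F] with zero integral there, so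
   [F] is null. *)
have [K0|K_neq0] := eqVneq K 0.
  suff PF0 : P F = 0%E by rewrite PF0 lee_fin.
  have : (\int[P]_(x in F) `|(f x)%:E| = 0)%E.
    apply/eqP; rewrite eq_le integral_ge0// andbT.
    rewrite K0 mulr0 in intF; apply: le_trans intF.
    rewrite le_eqVlt; apply/orP; left; apply/eqP/eq_integral => x.
    by rewrite inE => /FE/f_ge0 fx; rewrite gee0_abs// lee_fin.
  move=> /(ae_eq_integral_abs _ mF (mfE _ mF)) ae0.
  apply: measure_negligible => //; apply: negligibleS ae0 => x Fx /=.
  by move=> /(_ Fx)[fx0]; have := FK _ Fx; rewrite K0 fx0 ltxx.
have K_gt0 : 0 < K by rewrite lt0r K_neq0.
have : (\int[P]_(x in F) (cst K%:E) x <= (eta * K)%:E)%E.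
  apply: le_trans intF; apply: ge0_le_integral => //.
  - exact: mfE.
  - by move=> x /FK/ltW; rewrite lee_fin.
have -> : (\int[P]_(x in F) (cst K%:E) x = K%:E * P F)%E by exact: integral_cst.
have [p ->] := probability_fin P mF.
by rewrite -EFinM !lee_fin mulrC ler_pM2r.
Qed.

(** As [S] is nonnegative, its integral over [E] is at most [tau]; with [P E >= 1 - delta], the
    integral of [S - alpha * tau] over [E] is at most [tau - alpha * tau * (1 - delta)], that is
    [eta] times the threshold. Markov's inequality then removes at most [eta] from the probability
    of [E], without conditioning. *)
Lemma excess_probability (R : realType) d (T : measurableType d)
    (P : probability T R) (E : set T) (S : T -> R) (alpha delta eta tau : R) :
  measurable E -> P.-integrable [set: T] (EFin \o S) ->
  (forall w, 0 <= S w) -> (\int[P]_w (S w)%:E = tau%:E)%E ->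
  0 <= alpha -> alpha <= 1 -> 0 <= delta -> 0 < eta ->
  ((1 - delta)%:E <= P E)%E ->
  (forall w, E w -> alpha * tau <= S w) ->
  ((1 - delta - eta)%:E <=
   P (E `&` [set w | (S w - alpha * tau <=
                      (1 - alpha + alpha * delta) * tau / eta)%R]))%E.
Proof.
move=> mE iS S_ge0 intS a_ge0 a_le1 d_ge0 eta_gt0 PE SE.
have tau_ge0 : 0 <= tau.
  by rewrite -lee_fin -intS; apply: integral_ge0 => w _; rewrite lee_fin.
have mS : measurable_fun [set: T] S.
  by apply/measurable_EFinP; case/integrableP: iS.
set f := fun w => S w - alpha * tau; set K := _ * tau / eta.
have mf : measurable_fun [set: T] f.
  by apply: measurable_funB => //; exact: measurable_cst.
have K_ge0 : 0 <= K.
  by rewrite divr_ge0 ?(ltW eta_gt0)// mulr_ge0// addr_ge0 ?subr_ge0// mulr_ge0.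
have mG : measurable [set w | f w <= K].
  rewrite -[X in measurable X]setTI.
  by apply: measurable_fun_le => //; exact: measurable_cst.
have PF : (P (E `\` [set w | (f w <= K)%R]) <= eta%:E)%E.
  apply: markov_gt => //; last 1 first.
  - rewrite (eq_integral (fun w => (S w)%:E - (alpha * tau)%:E)%E); last first.
      by move=> w _; rewrite -EFinB.
    rewrite integralB_EFin//; last 2 first.
    + exact: (integrableS _ _ _ iS).
    + exact: (finite_measure_integrable_cst P (alpha * tau) mE).
    have -> : (\int[P]_(x in E) (alpha * tau)%:E =
        (alpha * tau)%:E * P E)%E.
      exact: integral_cst.
    have SEle : (\int[P]_(x in E) (S x)%:E <= tau%:E)%E.
      rewrite -intS; apply: ge0_subset_integral => //.
      + exact/measurable_EFinP.
      + by move=> w _; rewrite lee_fin.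
    apply: (le_trans (leeB SEle (lee_wpmul2l _ PE))).
      by rewrite lee_fin mulr_ge0.
    rewrite -EFinM -EFinB lee_fin /K mulrCA divff ?gt_eqF// mulr1.
    by rewrite le_eqVlt; apply/orP; left; apply/eqP; ring.
  - by move=> w /SE; rewrite subr_ge0.
  - exact: ltW.
have : (P E = P (E `\` [set w | (f w <= K)%R]) +
               P (E `&` [set w | (f w <= K)%R]))%E by exact: measureDI.
move: PE PF.
have mI := measurableI _ _ mE mG; have mD := measurableD mE mG.
have [a ->] := probability_fin P mE.
have [b ->] := probability_fin P mI.
have [c ->] := probability_fin P mD.
by rewrite -EFinD !lee_fin => PE PF [PDI]; move: PE PF PDI; lra.
Qed.

(** * Second moments under isotropy *)

Lemma isotropic_integrable (R : realType) (disp : measure_display)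
    (T : measurableType disp) (P : probability T R) d k
    (Om : T -> 'M[R]_(d, k)) :
  random_matrix Om ->
  expectation_mx P (fun w => Om w *m (Om w)^T) = map_mx EFin 1%:M ->
  forall i l,
    P.-integrable [set: T] (fun w => ((Om w *m (Om w)^T) i l)%:E).
Proof.
move=> mOm iso.
have mG i l : measurable_fun [set: T] (fun w => ((Om w *m (Om w)^T) i l)%:E).
  apply/measurable_EFinP.
  exact: (random_matrixM mOm (random_matrix_tr mOm)).
have diag_ge0 w i : 0 <= (Om w *m (Om w)^T) i i.
  by rewrite mxE sumr_ge0// => l _; rewrite mxE -expr2 sqr_ge0.
have intdiag i : P.-integrable [set: T] (fun w => ((Om w *m (Om w)^T) i i)%:E).
  apply/integrableP; split=> //.
  rewrite (eq_integral (fun w => ((Om w *m (Om w)^T) i i)%:E)); last first.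
    by move=> w _; rewrite gee0_abs// lee_fin.
  have /matrixP/(_ i i) := iso; rewrite !mxE unlock eqxx => ->.
  exact: ltry.
(* Diagonal entries are nonnegative with mean 1; all entries are dominated by sums of two of them,
   through [|a b| <= a^2 + b^2]. *)
move=> i l; apply: le_integrable (integrableD _ (intdiag i) (intdiag l)) => //.
move=> w _; rewrite /= lee_fin.
rewrite [leRHS]ger0_norm ?addr_ge0// !mxE -big_split /=.
apply: (le_trans (ler_norm_sum _ _ _)); apply: ler_sum => j _; rewrite !mxE.
rewrite ler_norml.
by move: (Om w i j) (Om w l j) => a b; apply/andP; split; nra.
Qed.

(** The squared norm is the quadratic form of [Om *m Om^T] at [x], linear in its integrable entries,
    so the expectation replaces that matrix by the identity. *)
Lemma isotropic_second_moment (R : realType) (disp : measure_display)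
    (T : measurableType disp) (P : probability T R) d k
    (Om : T -> 'M[R]_(d, k)) (x : 'cV[R]_d) :
  random_matrix Om ->
  expectation_mx P (fun w => Om w *m (Om w)^T) = map_mx EFin 1%:M ->
  P.-integrable [set: T] (fun w => (l2norm ((Om w)^T *m x) ^+ 2)%:E) /\
  (\int[P]_w (l2norm ((Om w)^T *m x) ^+ 2)%:E = (l2norm x ^+ 2)%:E)%E.
Proof.
move=> mOm iso; have intG := isotropic_integrable mOm iso.
have normE w : (l2norm ((Om w)^T *m x) ^+ 2)%:E =
    (\sum_i \sum_l (x i 0 * x l 0)%:E * ((Om w *m (Om w)^T) i l)%:E)%E.
  rewrite l2norm_sqr trmx_mul trmxK.
  have -> : x^T *m Om w *m ((Om w)^T *m x) = x^T *m ((Om w *m (Om w)^T) *m x).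
    by rewrite !mulmxA.
  move: (Om w *m _) => G; rewrite mxE -sumEFin; apply: eq_bigr => i _.
  rewrite [x^T 0 i]mxE [(G *m x) i 0]mxE mulr_sumr -sumEFin.
  by apply: eq_bigr => l _; rewrite -EFinM; congr EFin; ring.
have int1 i l : P.-integrable [set: T] (fun w =>
    (x i 0 * x l 0)%:E * ((Om w *m (Om w)^T) i l)%:E)%E.
  exact: integrableZl.
have int2 i : P.-integrable [set: T] (fun w =>
    \sum_l (x i 0 * x l 0)%:E * ((Om w *m (Om w)^T) i l)%:E)%E.
  exact: integrable_sum.
rewrite (funext normE); split; first exact: integrable_sum.
rewrite integral_sum//.
under eq_bigr => i _.
  rewrite integral_sum//.
  under eq_bigr => l _.
    rewrite integralZl//.
    have -> : (\int[P]_w ((Om w *m (Om w)^T) i l)%:E = (i == l)%:R%:E)%E.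
      by have /matrixP/(_ i l) := iso; rewrite !mxE unlock.
    over.
  over.
rewrite l2norm_sqr mxE -sumEFin; apply: eq_bigr => i _.
rewrite (bigD1 i)//= eqxx mule1 big1 ?adde0 ?mxE// => l li.
by rewrite eq_sym (negbTE li) mule0.
Qed.

(** * From the moment identity to the error probability *)

Theorem proposition4p2 (R : realType) (n d k r q : nat)
    (A : 'M[R]_(n, d))
    (U1 : 'M[R]_(n, r)) (s1 : 'rV[R]_r) (V1 : 'M[R]_(d, r))
    (U2 : 'M[R]_(n, q - r)) (s2 : 'rV[R]_(q - r)) (V2 : 'M[R]_(d, q - r))
    (disp : measure_display) (T : measurableType disp) (P : probability T R)
    (Omega : T -> 'M[R]_(d, k)) (alpha delta : R)
    (r_ge1 : (1 <= r)%N) (rank_A : \rank A = q) (q_gt_r : (r < q)%N)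
    (svd_A : reduced_svd A U1 s1 V1 U2 s2 V2)
    (k_gt_r : (r < k)%N)
    (Omega_random : random_matrix Omega)
    (alpha_gt0 : 0 < alpha) (alpha_le1 : alpha <= 1)
    (delta_ge0 : 0 <= delta) (delta_lt1 : delta < 1)
    (isotropic : expectation_mx P (fun w => Omega w *m (Omega w)^T) =
                 map_mx EFin 1%:M)
    (subspace_injection : ((1 - delta)%:E <=
       P [set w | forall (j : 'I_(q - r)) (x : 'cV[R]_d),
            x \in span_with V1 (col j V2) ->
            (alpha * l2norm x ^+ 2 <= l2norm ((Omega w)^T *m x) ^+ 2)%R])%E) :
  forall eta : R, 0 < eta -> eta < 1 ->
    let Ar := U1 *m diag_mx s1 *m V1^T in
    ((1 - delta - eta)%:E <=
      P [set w | (frobenius_norm (A - sketch_approx A (Omega w)) ^+ 2 <=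
                  (1 + (1 - alpha + alpha * delta) / (4 * alpha * eta)) *
                  frobenius_norm (A - Ar) ^+ 2)%R])%E.
Proof.
move=> eta eta_gt0 _ /=.
have [_ _ VV2 _] := reduced_svd_orthonormal svd_A.
have V2jj j : (V2^T *m V2) j j = 1 by rewrite VV2 mxE eqxx.
set tau := frobenius_norm _ ^+ 2.
have tauE : tau = \sum_j s2 0 j ^+ 2.
  have [UU _ _ _] := reduced_svd_orthonormal svd_A.
  have [AE _ _ _ _] := svd_A.
  rewrite /tau AE addrAC subrr add0r frobenius_norm_svd_sqr//.
  by apply: eq_bigr => j _; rewrite V2jj mulr1.
pose S w := \sum_j s2 0 j ^+ 2 * l2norm ((Omega w)^T *m col j V2) ^+ 2.
have moment j := isotropic_second_moment (col j V2) Omega_random isotropic.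
have SE : EFin \o S = fun w =>
    (\sum_j (s2 0 j ^+ 2)%:E * (l2norm ((Omega w)^T *m col j V2) ^+ 2)%:E)%E.
  by apply/funext => w; rewrite /= -sumEFin.
have int1 j : P.-integrable [set: T] (fun w =>
    (s2 0 j ^+ 2)%:E * (l2norm ((Omega w)^T *m col j V2) ^+ 2)%:E)%E.
  by apply: integrableZl => //; have [] := moment j.
have intS : P.-integrable [set: T] (EFin \o S).
  by rewrite SE; exact: integrable_sum.
have ES : (\int[P]_w (S w)%:E = tau%:E)%E.
  rewrite (_ : (fun w => (S w)%:E) = EFin \o S)// SE integral_sum//.
  rewrite tauE -sumEFin; apply: eq_bigr => j _.
  have [intj Ej] := moment j.
  by rewrite integralZl// Ej l2norm_col_sqr V2jj mule1.
have S_ge0 w : 0 <= S w.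
  by apply: sumr_ge0 => j _; rewrite mulr_ge0 ?sqr_ge0.
pose E := [set w | forall j,
  injects_on alpha (Omega w) (span_with V1 (col j V2))].
have mE : measurable E := measurable_injects_on alpha V1 V2 Omega_random.
(* Testing the injection on the unit vector [v_j] itself gives the lower bound that Markov's
   inequality needs. *)
have S_ge w : E w -> alpha * tau <= S w.
  move=> Ew; rewrite tauE mulr_sumr; apply: ler_sum => j _.
  rewrite mulrC ler_wpM2l ?sqr_ge0//.
  have /(Ew j) : col j V2 \in span_with V1 (col j V2).
    by apply/mem_span_with; exists 0, 1; rewrite mulmx0 add0r scale1r.
  by rewrite l2norm_col_sqr V2jj mulr1.
have mS : measurable_fun [set: T] S.
  by apply/measurable_EFinP; case/integrableP: intS.
apply: (le_trans (excess_probability mE intS S_ge0 ES (ltW alpha_gt0) alpha_le1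
  delta_ge0 eta_gt0 subspace_injection S_ge)).
(* Monotonicity of [P] requires both events to be measurable. *)
apply: le_measure; rewrite ?inE.
- apply: measurableI => //; rewrite -[X in measurable X]setTI.
  apply: measurable_fun_le => //.
  by apply: measurable_funB => //; exact: measurable_cst.
- exact: measurable_sketch_error_le.
move=> w [/= Ew Sw].
apply: le_trans (sketch_error_le alpha_gt0 _ svd_A Ew) _.
  by rewrite subn_gt0.
rewrite -tauE -/(S w) [leRHS]mulrDl mul1r lerD2l ler_pdivrMr ?mulr_gt0//.
(* Dividing the excess threshold by [4 * alpha] gives exactly the claimed constant times [tau]. *)
apply: (le_trans Sw); rewrite le_eqVlt; apply/orP; left; apply/eqP.
by field; rewrite !gt_eqF.
Qed.
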